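(* Let the sequences be generated by Algorithm 1 (described in the context), assumed not to stop, and let $d_{0,\gamma}$ denote the distance, in the norm $\|\cdot\|_\gamma$, of $p^0$ to $\mathcal S_e$. Suppose there exist $\overline\lambda\ge\underline\lambda>0$ such that $\lambda_i^k\in[\underline\lambda,\overline\lambda]$ for all $k\ge0$ and $i=1,\dots,n$, that $\overline\alpha:=\sup_{k\ge0}\alpha_k<+\infty$, and that $\overline s:=\sum_{k=0}^\infty\beta_k^2<+\infty$; put $\overline\beta:=\sup_{k\ge0}\beta_k$ and $$\Omega_{(\alpha,\beta)}:=(1+\overline\alpha)\Big[(1+\overline\beta)\big[1+\overline\alpha(1+\overline\beta)\big]+\overline s\Big].$$ Then, for all $k\ge0$, there exists $\ell\in\{0,1,\dots,k\}$ such that $$y_i^\ell\in T_i^{[\varepsilon_i^\ell]}(x_i^\ell),\quad i=1,\dots,n,$$ $$\Big\|\sum_{i=1}^{n-1}G_i^*y_i^\ell+y_n^\ell\Big\|\le\frac{n\big(\max_{i=1,\dots,n}\|G_i\|^2\big)d_{0,\gamma}}{\sqrt{k+1}}\left(\frac{4\sqrt\gamma\max\{1,1/\gamma\}\sqrt{\Omega_{(\alpha,\beta)}}}{(1-\sigma^2)\min\{\underline\lambda,1/\overline\lambda\}}\right),$$ $$\|x_i^\ell-G_ix_n^\ell\|\le\frac{n\big(\max_{i=1,\dots,n}\|G_i\|^2\big)d_{0,\gamma}}{\sqrt{k+1}}\left(\frac{4\max\{1,1/\gamma\}\sqrt{\Omega_{(\alpha,\beta)}}}{(1-\sigma^2)\min\{\underline\lambda,1/\overline\lambda\}}\right),\quad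 i=1,\dots,n-1,$$ $$\sum_{i=1}^n\varepsilon_i^\ell\le\frac{n\big(\max_{i=1,\dots,n}\|G_i\|^2\big)d_{0,\gamma}^2}{k+1}\left(\frac{4\sigma^2\max\{1,1/\gamma\}\,\Omega_{(\alpha,\beta)}}{(1-\sigma^2)^2\min\{\underline\lambda,1/\overline\lambda\}}\right).$$
   Context: Setting. Let $n\ge2$, let $\mathcal H_0,\dots,\mathcal H_{n-1}$ be real Hilbert spaces, and $\mathcal H_n:=\mathcal H_0$; inner products and norms are written $\langle\cdot,\cdot\rangle$ and $\|\cdot\|$. For $i=1,\dots,n$, $T_i:\mathcal H_i\rightrightarrows\mathcal H_i$ is a (set-valued) maximal monotone operator and $G_i:\mathcal H_0\to\mathcal H_i$ is a bounded linear operator with adjoint $G_i^*$ and operator norm $\|G_i\|$; $G_n=I$ is the identity. The problem is to find $z\in\mathcal H_0$ with $0\in\sum_{i=1}^nG_i^*T_i(G_iz)$; it is assumed to have at least one solution. For a set-valued map $T$ on a Hilbert space and $\varepsilon\ge0$, $T^{[\varepsilon]}(x)=\{u:\langle x-y,u-v\rangle\ge-\varepsilon\text{ for all }y\text{ and all }v\in T(y)\}$. For $\gamma>0$, the space $\boldsymbol{\mathcal H}:=\mathcal H_0\times\mathcal H_1\times\dots\times\mathcal H_{n-1}$ carries $\langle (z,w),(z',w')\rangle_\gamma=\gamma\langle z,z'\rangle+\sum_{i=1}^{n-1}\langle w_i,w_i'\rangle$ and $\|p\|_\gamma=\sqrt{\langle p,p\rangle_\gamma}$; $P_C$ denotes orthogonal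 projection onto a nonempty closed convex set $C$ in this space. The extended-solution set is the (nonempty closed convex) set $$\mathcal S_e=\Big\{(z,w_1,\dots,w_{n-1})\in\boldsymbol{\mathcal H}: w_i\in T_i(G_iz),\ i=1,\dots,n-1,\ -\sum_{i=1}^{n-1}G_i^*w_i\in T_n(z)\Big\}.$$ Algorithm 1. Input: $p^{-1}=p^0=(z^0,w_1^0,\dots,w_{n-1}^0)\in\boldsymbol{\mathcal H}$ (so $z^{-1}=z^0$, $w_i^{-1}=w_i^0$), $0\le\sigma<1$, $\gamma>0$. For $k=0,1,\dots$: (1) Choose $\alpha_k,\beta_k\ge0$ and set $\widehat z^k=z^k+\alpha_k(z^k-z^{k-1})$, $\widetilde z^k=\widehat z^k+\beta_k(\widehat z^k-z^0)$; for $i=1,\dots,n-1$: $\widehat w_i^k=w_i^k+\alpha_k(w_i^k-w_i^{k-1})$, $\widetilde w_i^k=\widehat w_i^k+\beta_k(\widehat w_i^k-w_i^0)$; and $\widetilde w_n^k=-\sum_{i=1}^{n-1}G_i^*\widetilde w_i^k$. (2) For $i=1,\dots,n$, choose $\lambda_i^k>0$ and compute $(x_i^k,y_i^k,\varepsilon_i^k)\in\mathcal H_i\times\mathcal H_i\times[0,\infty)$ with $y_i^k\in T_i^{[\varepsilon_i^k]}(x_i^k)$ and $$\|\lambda_i^ky_i^k+x_i^k-(G_i\widetilde z^k+\lambda_i^k\widetilde w_i^k)\|^2+2\lambda_i^k\varepsilon_i^k\le\sigma^2\big(\|G_i\widetilde z^k-x_i^k\|^2+\|\lambda_i^k(\widetilde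 w_i^k-y_i^k)\|^2\big).$$ (3) If $x_i^k=G_ix_n^k$ for $i=1,\dots,n-1$ and $\sum_{i=1}^{n-1}G_i^*y_i^k+y_n^k=0$, stop and return $(\overline z,\overline w_1,\dots,\overline w_{n-1}):=(x_n^k,y_1^k,\dots,y_{n-1}^k)$. (4) Otherwise let $\varphi_k(p)=\sum_{i=1}^n\big(\langle G_iz-x_i^k,y_i^k-w_i\rangle-\varepsilon_i^k\big)$ for $p=(z,w_1,\dots,w_{n-1})$, with $w_n:=-\sum_{i=1}^{n-1}G_i^*w_i$; let $p^k=(z^k,w_1^k,\dots,w_{n-1}^k)$, $H_k=\{p:\varphi_k(p)\le0\}$, $W_k=\{p:\langle p^0-p^k,p-p^k\rangle_\gamma\le0\}$, and set $p^{k+1}=(z^{k+1},w_1^{k+1},\dots,w_{n-1}^{k+1})=P_{H_k\cap W_k}(p^0)$.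
   Formalization: The space H_0 is additionally assumed to be nonzero; for H_0 = {0} every ‖G_i‖ is 0, the stated bounds are all 0, and the bound on ‖x_i − G_i x_n‖ fails for every non-stopping run. *)

(* Defs.v *)
From HB Require Import structures.
From mathcomp Require Import all_boot all_order all_algebra.
From mathcomp Require Import all_classical all_reals all_analysis.
Set Implicit Arguments.
Unset Strict Implicit.
Unset Printing Implicit Defensive.
Import Order.TTheory GRing.Theory Num.Theory.
Import numFieldNormedType.Exports.
Local Open Scope classical_set_scope.
Local Open Scope ring_scope.

(* Real Hilbert spaces: complete normed spaces whose norm comes from an inner
   product (positive definiteness follows from [hdot_norm]). *)
HB.mixin Record isHilbert (R : realType) V of CompleteNormedModule R V := {
  hdot : V -> V -> R ;
  hdotC : forall x y, hdot x y = hdot y x ;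
  hdotDl : forall x y z, hdot (x + y) z = hdot x z + hdot y z ;
  hdotZl : forall a x y, hdot (a *: x) y = a * hdot x y ;
  hdot_norm : forall x, `|x| ^+ 2 = hdot x x
}.

#[short(type="hilbertType")]
HB.structure Definition Hilbert (R : realType) :=
  { V of CompleteNormedModule R V & isHilbert R V }.

Section operators.
Variable R : realType.

Definition is_adjoint (U V : hilbertType R) (f : U -> V) (g : V -> U) : Prop :=
  forall u v, hdot (f u) v = hdot u (g v).

Definition opnorm (U V : hilbertType R) (f : U -> V) : R :=
  sup [set `|f x| | x in [set x | `|x| <= 1]].

(* A set-valued map is a function [V -> set V]; [T x u] means u \in T(x). *)
Definition monotone_op (V : hilbertType R) (T : V -> set V) : Prop :=
  forall x y u v, T x u -> T y v -> 0 <= hdot (x - y) (u - v).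

Definition maximal_monotone (V : hilbertType R) (T : V -> set V) : Prop :=
  monotone_op T /\
  forall S : V -> set V, monotone_op S ->
    (forall x, T x `<=` S x) -> forall x, S x `<=` T x.

Definition enlargement (V : hilbertType R) (T : V -> set V) (eps : R) (x : V) :
    set V :=
  [set u | forall y v, T y v -> - eps <= hdot (x - y) (u - v)].

Definition hat (V : hilbertType R) (a : R) (u uprev : V) : V :=
  u + a *: (u - uprev).

Definition tilde (V : hilbertType R) (b : R) (u0 uhat : V) : V :=
  uhat + b *: (uhat - u0).

End operators.

Section problem.
Variables (R : realType) (n : nat).
(* [H j] is the (j+1)-st space of the list, so that the spaces 1, ..., n-1 are
   indexed by j : 'I_n.-1. *)
Variables (H0 : hilbertType R) (H : 'I_n.-1 -> hilbertType R).

(* The indices 1, ..., n are encoded by [option 'I_n.-1]: [Some j] is j+1 and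
   [None] is n; the n-th space is H0. *)
Definition hspace (i : option 'I_n.-1) : hilbertType R :=
  match i with Some j => H j | None => H0 end.

Definition pspace : Type := (H0 * (forall j : 'I_n.-1, H j))%type.

Definition psub (p q : pspace) : pspace :=
  (p.1 - q.1, fun j => p.2 j - q.2 j).

Definition gdot (gamma : R) (p q : pspace) : R :=
  gamma * hdot p.1 q.1 + \sum_(j < n.-1) hdot (p.2 j) (q.2 j).

Definition gnorm (gamma : R) (p : pspace) : R := Num.sqrt (gdot gamma p p).

Definition gdist (gamma : R) (p : pspace) (C : set pspace) : R :=
  inf [set gnorm gamma (psub p q) | q in C].

(* q is the orthogonal projection of p onto C *)
Definition is_proj (gamma : R) (C : set pspace) (p q : pspace) : Prop :=
  C q /\ forall r, C r -> gnorm gamma (psub p q) <= gnorm gamma (psub p r).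

Variables (T : forall i, hspace i -> set (hspace i)).
Variables (G : forall i, H0 -> hspace i) (Gadj : forall i, hspace i -> H0).
Variables (sigma gamma : R).

Definition is_solution (z : H0) : Prop :=
  exists u : forall i, hspace i,
    (forall i, T (G i z) (u i)) /\ \sum_i Gadj (u i) = 0.

(* (w_1, ..., w_{n-1}) completed by w_n := - sum_{i < n} G_i^* w_i *)
Definition wfull (w : forall j, H j) (i : option 'I_n.-1) : hspace i :=
  match i return hspace i with
  | Some j => w j
  | None => - \sum_(j < n.-1) Gadj (i := Some j) (w j)
  end.

Definition extended_solutions : set pspace :=
  [set p | (forall j, T (i := Some j) (G (Some j) p.1) (p.2 j)) /\
           T (i := None) p.1 (- \sum_(j < n.-1) Gadj (i := Some j) (p.2 j))].

Variables (alpha beta : nat -> R) (lambda : nat -> option 'I_n.-1 -> R).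
Variables (p : nat -> pspace) (x y : nat -> forall i, hspace i).
Variable eps : nat -> option 'I_n.-1 -> R.

(* The previous iterate is [p k.-1]; since 0.-1 = 0 this also encodes the
   convention p^{-1} = p^0. *)
Definition ztilde (k : nat) : H0 :=
  tilde (beta k) (p 0).1 (hat (alpha k) (p k).1 (p k.-1).1).

Definition wtilde (k : nat) (j : 'I_n.-1) : H j :=
  tilde (beta k) ((p 0).2 j) (hat (alpha k) ((p k).2 j) ((p k.-1).2 j)).

Definition error_criterion (k : nat) (i : option 'I_n.-1) : Prop :=
  let Gz := G i (ztilde k) in
  let w := wfull (wtilde k) i in
  let l := lambda k i in
  `|l *: y k i + x k i - (Gz + l *: w)| ^+ 2 + 2 * l * eps k i
    <= sigma ^+ 2 * (`|Gz - x k i| ^+ 2 + `|l *: (w - y k i)| ^+ 2).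

Definition dual_residual (k : nat) : H0 :=
  \sum_(j < n.-1) Gadj (y k (Some j)) + y k None.

Definition primal_residual (k : nat) (j : 'I_n.-1) : H j :=
  x k (Some j) - G (Some j) (x k None).

Definition stops (k : nat) : Prop :=
  (forall j, x k (Some j) = G (Some j) (x k None)) /\ dual_residual k = 0.

Definition phi (k : nat) (q : pspace) : R :=
  \sum_i (hdot (G i q.1 - x k i) (y k i - wfull q.2 i) - eps k i).

Definition halfH (k : nat) : set pspace := [set q | phi k q <= 0].

Definition halfW (k : nat) : set pspace :=
  [set q | gdot gamma (psub (p 0) (p k)) (psub q (p k)) <= 0].

(* an infinite (that is, non-stopping) run of the algorithm *)
Record nonstopping_run : Prop := NonstoppingRun {
  run_alpha : forall k, 0 <= alpha k ;
  run_beta : forall k, 0 <= beta k ;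
  run_lambda : forall k i, 0 < lambda k i ;
  run_eps : forall k i, 0 <= eps k i ;
  run_enlargement : forall k i, enlargement (@T i) (eps k i) (x k i) (y k i) ;
  run_error : forall k i, error_criterion k i ;
  run_nonstop : forall k, ~ stops k ;
  run_step : forall k, is_proj gamma (halfH k `&` halfW k) (p 0) (p k.+1)
}.

End problem.

Definition Omega (R : realType) (abar bbar sbar : R) : R :=
  (1 + abar) * ((1 + bbar) * (1 + abar * (1 + bbar)) + sbar).

(* Main.v *)
Require Import Defs.
From HB Require Import structures.
From mathcomp Require Import all_boot all_order all_algebra.
From mathcomp Require Import all_classical all_reals all_analysis.
From mathcomp Require Import ring lra.
Set Implicit Arguments.
Unset Strict Implicit.
Unset Printing Implicit Defensive.
Import Order.TTheory GRing.Theory Num.Theory.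
Import numFieldNormedType.Exports.
Local Open Scope classical_set_scope.
Local Open Scope ring_scope.

(** The algorithm is Haugazeau's outer approximation scheme applied to
   separating half-spaces.  Every extended solution lies in each H_k, because
   y_i^k belongs to an enlargement of T_i at x_i^k, and, by the obtuse-angle
   property of projections, in each W_k.  Hence the iterates stay within
   d_0 of p^0, their distances to p^0 increase, and the squared lengths of the
   steps p^{k+1} - p^k sum to at most d_0^2 ([sum_steps_le]).

   The half-space H_k is built at the extrapolated point p~^k, not at p^k.  The
   step p^{k+1} - p~^k is e - a (1 + b) f - b q with e, f the current and the
   previous step and q = p^k - p^0.  As <e, q> >= 0, its square is bounded by
   weighted squares of e, f and q ([inertial_halpern_step]); the weights are the
   ones that appear in Omega, so that the squares of p^{k+1} - p~^k sum to at
   most Omega d_0^2 ([sum_inertial_le]).  One of the first k + 1 of them is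
   therefore at most E = Omega d_0^2 / (k + 1).

   At such an index everything is controlled by E.  The relative error criterion
   makes phi_k(p~^k) at least a multiple of the sum of the squares of the
   discrepancies G_i z~ - x_i and w~_i - y_i ([phi_pt_ge]).  The gradient of the
   affine function phi_k is (dual residual / gamma, primal residuals), and it is
   controlled by the same sum ([grad_sq_le]); so its square is at most
   K phi_k(p~^k).  Since phi_k(p^{k+1}) <= 0, also phi_k(p~^k) is at most the
   inner product of the gradient with p~^k - p^{k+1}; Young's inequality then
   bounds the squared gradient by K^2 E and phi_k(p~^k) by K E
   ([iteration_bounds]).  The errors eps_i are in turn bounded by
   sigma^2 / (1 - sigma^2) times phi_k(p~^k) ([sum_eps_le]). *)

(** * Positive semidefinite forms and projections *)

(** The geometry below is needed both for [hdot] on each space and for [gdot]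
   on their product, hence the abstraction over the form. *)
Record semi_inner (R : realType) (V : lmodType R) (B : V -> V -> R) : Prop :=
  SemiInner {
  siC : forall u v, B u v = B v u ;
  siDl : forall u v w, B (u + v) w = B u w + B v w ;
  siZl : forall a u v, B (a *: u) v = a * B u v ;
  si_ge0 : forall u, 0 <= B u u }.

Section semi_inner_theory.
Context (R : realType) (V : lmodType R) (B : V -> V -> R).
Hypothesis hB : semi_inner B.

Lemma siNl u v : B (- u) v = - B u v.
Proof. by rewrite -scaleN1r (siZl hB) mulN1r. Qed.

Lemma siDr u v w : B w (u + v) = B w u + B w v.
Proof. by rewrite siC // siDl // !(siC hB w). Qed.

Lemma siZr a u v : B u (a *: v) = a * B u v.
Proof. by rewrite siC // siZl // (siC hB u). Qed.

Lemma siNr u v : B u (- v) = - B u v.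
Proof. by rewrite siC // siNl (siC hB u). Qed.

Definition siE := (siDl hB, siDr, siZl hB, siZr, siNl, siNr).

Lemma si_young (t : R) u v : 0 < t -> 2 * B u v <= t^-1 * B u u + t * B v v.
Proof.
move=> t0; have := si_ge0 hB (u - t *: v).
rewrite !siE (siC hB v u) => h.
have ti : 0 < t^-1 by rewrite invr_gt0.
have tt : t^-1 * t = 1 by rewrite mulVf // gt_eqF.
have : 0 <= t^-1 * (B u u + - (t * B u v) + - (t * (B u v + - (t * B v v)))).
  by apply: mulr_ge0; [exact: ltW|lra].
suff -> : t^-1 * (B u u + - (t * B u v) + - (t * (B u v + - (t * B v v)))) =
  t^-1 * B u u - 2 * (t^-1 * t) * B u v + (t^-1 * t) * (t * B v v).
  by rewrite tt; lra.
ring.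
Qed.

(** One extrapolated step.  The difference of the two sides is
   a |e + (1 + b) f - b q|^2 + (1 + a) b (|e|^2 + 2 <e, q>).  Bounding the
   cross terms separately loses too much: the sign of <e, q> is what rules out
   the worst alignment of e, f and q. *)
Lemma inertial_halpern_step (a b : R) e f q : 0 <= a -> 0 <= b -> 0 <= B e q ->
  B (e - (a * (1 + b)) *: f - b *: q) (e - (a * (1 + b)) *: f - b *: q) <=
  (1 + a) * (1 + b) * B e e + a * (1 + a) * (1 + b) ^+ 2 * B f f
  + (1 + a) * b ^+ 2 * B q q.
Proof.
move=> a0 b0 eq0.
have h1 : 0 <= a * B (e + (1 + b) *: f - b *: q) (e + (1 + b) *: f - b *: q).
  by rewrite mulr_ge0 // si_ge0.
have h2 : 0 <= (1 + a) * b * (B e e + 2 * B e q).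
  by apply: mulr_ge0; [apply: mulr_ge0; lra|have := si_ge0 hB e; lra].
rewrite -subr_ge0; apply: le_trans (addr_ge0 h1 h2) _.
rewrite !siE (siC hB f e) (siC hB q e) (siC hB q f) le_eqVlt; apply/orP; left.
by apply/eqP; ring.
Qed.

Definition nearest (C : set V) (p q : V) :=
  C q /\ forall r, C r -> B (p - q) (p - q) <= B (p - r) (p - r).

Definition segment_closed (C : set V) := forall q r (t : R), 0 <= t <= 1 ->
  C q -> C r -> C (q + t *: (r - q)).

(** Moving from the nearest point q towards r by a small fraction t of r - q
   cannot come closer to p; the first-order term in t has the stated sign. *)
Lemma nearest_obtuse (C : set V) p q r : segment_closed C -> nearest C p q ->
  C r -> B (p - q) (r - q) <= 0.
Proof.
move=> cC [Cq minq] Cr; rewrite leNgt; apply/negP => c0.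
set c := B (p - q) (r - q) in c0; set N := B (r - q) (r - q).
have N0 : 0 <= N by exact: si_ge0.
have cN : 0 < c + N by lra.
(* With c > 0 this t is small enough for 2 t c to exceed t^2 N. *)
set t := c / (c + N).
have t0 : 0 < t by rewrite divr_gt0.
have tN : t * (c + N) = c by rewrite divfK // gt_eqF.
have t1 : t <= 1 by rewrite ler_pdivrMr //; lra.
have := minq _ (cC q r t _ Cq Cr); rewrite t1 ltW // => /(_ isT).
have -> : p - (q + t *: (r - q)) = (p - q) + - (t *: (r - q)).
  by rewrite opprD addrA.
rewrite [leRHS](_ : _ = B (p - q) (p - q) - 2 * t * c + t * (t * N));
  last first.
  rewrite (siDl hB (p - q)) siDr (siDr (p - q)) !siNl !siNr !(siZl hB) !siZr.
  by rewrite -/c -/N (siC hB (r - q) (p - q)) -/c; ring.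
move=> h; have h' : t * (2 * c) <= t * (t * N) by lra.
rewrite ler_pM2l // in h'.
have : 0 < t * c by rewrite mulr_gt0.
lra.
Qed.

End semi_inner_theory.

(** * Haugazeau's scheme with inertial and anchored extrapolation *)

Section haugazeau.
Context (R : realType) (V : lmodType R) (B : V -> V -> R).
Hypothesis hB : semi_inner B.
Variables (p : nat -> V) (Hs : nat -> set V) (S : set V).
Let Ws k : set V := [set q | B (p 0%N - p k) (q - p k) <= 0].
Hypothesis Hs_convex : forall k, segment_closed (Hs k).
Hypothesis S_sub : forall k, S `<=` Hs k.
Hypothesis step : forall k, nearest B (Hs k `&` Ws k) (p 0%N) (p k.+1).

Lemma cut_segment_closed k : segment_closed (Hs k `&` Ws k).
Proof.
move=> q r t t01 [Hq Wq] [Hr Wr]; split; first exact: Hs_convex.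
rewrite /Ws /=; move: Wq Wr; rewrite /Ws /=.
have -> : q + t *: (r - q) - p k = (1 - t) *: (q - p k) + t *: (r - p k).
  have -> : r - q = (r - p k) - (q - p k) by rewrite opprB addrA subrK.
  by rewrite addrAC scalerBr scalerBl scale1r -[RHS]addrA [- _ + _]addrC.
move=> hq hr; rewrite (siDr hB) !(siZr hB).
have := mulr_ge0_le0 (_ : 0 <= 1 - t) hq; have := mulr_ge0_le0 (_ : 0 <= t) hr.
by case/andP: t01 => t0 t1; move=> /(_ t0) ? /(_ ltac:(lra)) ?; lra.
Qed.

(** Points of [S] lie in the set that is projected onto at step k, and the
   obtuse-angle property of that projection is membership in [Ws k.+1]. *)
Lemma solutions_kept k : S `<=` Ws k.
Proof.
elim: k => [|k IH] q Sq.
  by rewrite /Ws /= subrr -(scale0r 0) (siZl hB) mul0r.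
apply: (nearest_obtuse hB (@cut_segment_closed k)) => //.
by split; [exact: S_sub|exact: IH].
Qed.

(** Membership of p^{k+1} in [Ws k] makes the angle at p^k obtuse, so the
   Pythagorean identity becomes an inequality in the useful direction. *)
Lemma dist_increase k : B (p k - p 0%N) (p k - p 0%N)
   + B (p k.+1 - p k) (p k.+1 - p k) <= B (p k.+1 - p 0%N) (p k.+1 - p 0%N).
Proof.
have [[_ /=]] := step k; rewrite /Ws /=.
have -> : p 0%N - p k = - (p k - p 0%N) by rewrite opprB.
rewrite (siNl hB) => h _.
have -> : p k.+1 - p 0%N = (p k - p 0%N) + (p k.+1 - p k).
  by rewrite [RHS]addrC subrKA.
rewrite (siDl hB (p k - _)) !(siDr hB (p k - _)).
by rewrite (siC hB (p k.+1 - p k) (p k - p 0%N)); lra.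
Qed.

Lemma step_obtuse k : 0 <= B (p k.+1 - p k) (p k - p 0%N).
Proof.
have [[_ /=]] := step k; rewrite /Ws /=.
by rewrite -opprB (siNl hB) oppr_le0 (siC hB).
Qed.

Lemma sum_steps_le k :
  \sum_(0 <= j < k) B (p j.+1 - p j) (p j.+1 - p j) <=
    B (p k - p 0%N) (p k - p 0%N).
Proof.
elim: k => [|k IH]; first by rewrite big_nil si_ge0.
by rewrite big_nat_recr //=; have := dist_increase k; lra.
Qed.

Lemma dist_le_solution k s : S s ->
  B (p k - p 0%N) (p k - p 0%N) <= B (p 0%N - s) (p 0%N - s).
Proof.
move=> Ss; case: k => [|k].
  by rewrite subrr -(scale0r 0) (siZl hB) mul0r si_ge0.
have [_ /(_ s)] := step k.
rewrite -(opprB (p 0%N)) (siNl hB) (siNr hB) opprK; apply.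
by split; [exact: S_sub|exact: solutions_kept].
Qed.

(** Summing [inertial_halpern_step]: the e-terms and the f-terms both sum to at
   most d2 by [sum_steps_le], and the q-terms to at most s * d2. *)
Lemma sum_inertial_le (alpha beta : nat -> R) (pt : nat -> V) (a b s d2 : R) k :
  let ph j := p j + alpha j *: (p j - p j.-1) in
  (forall j, pt j = ph j + beta j *: (ph j - p 0%N)) ->
  (forall j, 0 <= alpha j <= a) -> (forall j, 0 <= beta j <= b) ->
  \sum_(0 <= j < k) beta j ^+ 2 <= s ->
  (forall j, B (p j - p 0%N) (p j - p 0%N) <= d2) ->
  \sum_(0 <= j < k) B (pt j - p j.+1) (pt j - p j.+1) <= Omega a b s * d2.
Proof.
move=> ph ptE ha hb hs hd.
have a0 : 0 <= a by have /andP[h1 h2] := ha 0%N; exact: le_trans h2.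
have b0 : 0 <= b by have /andP[h1 h2] := hb 0%N; exact: le_trans h2.
have d0 : 0 <= d2 by apply: le_trans (hd 0%N); exact: si_ge0.
pose D j := B (p j - p j.-1) (p j - p j.-1).
have D0 j : 0 <= D j by exact: si_ge0.
have bound j : B (pt j - p j.+1) (pt j - p j.+1) <=
    (1 + a) * (1 + b) * D j.+1 + a * (1 + a) * (1 + b) ^+ 2 * D j
    + (1 + a) * d2 * beta j ^+ 2.
  have /andP[aj0 aja] := ha j; have /andP[bj0 bjb] := hb j.
  rewrite -(opprB (p j.+1)) (siNl hB) (siNr hB) opprK.
  have -> : p j.+1 - pt j = (p j.+1 - p j)
      - (alpha j * (1 + beta j)) *: (p j - p j.-1) - beta j *: (p j - p 0%N).
    have phE : ph j - p 0%N = (p j - p 0%N) + alpha j *: (p j - p j.-1).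
      by rewrite /ph addrAC.
    rewrite ptE phE scalerDr scalerA mulrDr mulr1 (mulrC (beta j)) scalerDl.
    by rewrite /ph !opprD !addrA addrAC.
  apply: le_trans (inertial_halpern_step hB _ aj0 bj0 (step_obtuse j)) _.
  apply: lerD; first apply: lerD.
  - by apply: ler_wpM2r; [exact: D0|apply: ler_pM; lra].
  - apply: ler_wpM2r; first exact: D0.
    apply: ler_pM; rewrite ?mulr_ge0 ?exprn_ge0 ?lerXn2r ?nnegrE ?addr_ge0 //.
      by apply: ler_pM; lra.
    by lra.
  - rewrite [leRHS]mulrAC; apply: ler_pM; last exact: hd.
    + by apply: mulr_ge0; [lra|exact: sqr_ge0].
    + exact: si_ge0.
    + by apply: ler_wpM2r; [exact: sqr_ge0|lra].
have sumD1 : \sum_(0 <= j < k) D j.+1 <= d2.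
  exact: le_trans (sum_steps_le k) _.
have sumD : \sum_(0 <= j < k) D j <= d2.
  (* The extra initial term vanishes since p^{-1} = p^0. *)
  case: k sumD1 {hs} => [|k] h; first by rewrite big_nil.
  rewrite big_nat_recl //= {1}/D /= subrr -(scale0r 0) (siZl hB) mul0r add0r.
  exact: le_trans (sum_steps_le k) _.
apply: le_trans (ler_sum _ (fun j _ => bound j)) _.
rewrite !big_split /= -!mulr_sumr.
have -> : Omega a b s * d2 = (1 + a) * (1 + b) * d2
  + a * (1 + a) * (1 + b) ^+ 2 * d2 + (1 + a) * d2 * s by rewrite /Omega; ring.
by apply: lerD; first apply: lerD; apply: ler_wpM2l;
  rewrite ?mulr_ge0 ?exprn_ge0 ?addr_ge0.
Qed.

End haugazeau.

(** * The product space *)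

Section pspace_lmod.
Context (R : realType) (n : nat).
Context (H0 : hilbertType R) (H : 'I_n.-1 -> hilbertType R).
Notation E := (pspace H0 H).

HB.instance Definition _ := gen_eqMixin E.
HB.instance Definition _ := gen_choiceMixin E.

(* With these operations [p - q] is convertible to [psub p q]. *)
Let padd (p q : E) : E := (p.1 + q.1, fun j => p.2 j + q.2 j).
Let popp (p : E) : E := (- p.1, fun j => - p.2 j).
Let pzero : E := (0, fun j => 0).
Let pscale (a : R) (p : E) : E := (a *: p.1, fun j => a *: p.2 j).

Lemma pspaceP (p q : E) : p.1 = q.1 -> (forall j, p.2 j = q.2 j) -> p = q.
Proof.
case: p q => [p1 p2] [q1 q2] /= -> h; congr pair.
exact: functional_extensionality_dep.
Qed.

Let paddA : associative padd.
Proof. by move=> p q r; apply: pspaceP => [|j] /=; rewrite addrA. Qed.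
Let paddC : commutative padd.
Proof. by move=> p q; apply: pspaceP => [|j] /=; rewrite addrC. Qed.
Let padd0 : left_id pzero padd.
Proof. by move=> p; apply: pspaceP => [|j] /=; rewrite add0r. Qed.
Let paddN : left_inverse pzero popp padd.
Proof. by move=> p; apply: pspaceP => [|j] /=; rewrite addNr. Qed.

HB.instance Definition _ := GRing.isZmodule.Build E paddA paddC padd0 paddN.

Let pscaleA a b (v : E) : pscale a (pscale b v) = pscale (a * b) v.
Proof. by apply: pspaceP => [|j] /=; rewrite scalerA. Qed.
Let pscale1 : left_id 1 pscale.
Proof. by move=> p; apply: pspaceP => [|j] /=; rewrite scale1r. Qed.
Let pscaleDr : right_distributive pscale +%R.
Proof. by move=> a p q; apply: pspaceP => [|j] /=; rewrite scalerDr. Qed.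
Let pscaleDl (v : E) : {morph pscale^~ v : a b / a + b}.
Proof. by move=> a b; apply: pspaceP => [|j] /=; rewrite scalerDl. Qed.

HB.instance Definition _ :=
  GRing.Zmodule_isLmodule.Build R E pscaleA pscale1 pscaleDr pscaleDl.

End pspace_lmod.

Lemma hdot_semi_inner (R : realType) (V : hilbertType R) :
  semi_inner (@hdot R V).
Proof.
split; [exact: hdotC|exact: hdotDl|exact: hdotZl|].
by move=> u; rewrite -hdot_norm exprn_ge0.
Qed.

Lemma gdot_semi_inner (R : realType) n (H0 : hilbertType R)
  (H : 'I_n.-1 -> hilbertType R) (gamma : R) : 0 < gamma ->
  semi_inner (@gdot R n H0 H gamma).
Proof.
move=> g0; split.
- move=> u v; rewrite /gdot hdotC; congr (_ + _).
  by apply: eq_bigr => j _; rewrite hdotC.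
- move=> u v w; rewrite /gdot /= hdotDl mulrDr addrACA -big_split /=.
  by congr (_ + _); apply: eq_bigr => j _; rewrite hdotDl.
- move=> a u v; rewrite /gdot /= hdotZl mulrDr mulr_sumr mulrCA.
  by congr (_ + _); apply: eq_bigr => j _; rewrite hdotZl.
- have hge0 (V : hilbertType R) (v : V) : 0 <= hdot v v.
    exact: si_ge0 (hdot_semi_inner V) v.
  move=> u; apply: addr_ge0; first by apply: mulr_ge0; [exact: ltW|exact: hge0].
  by apply: sumr_ge0 => j _; exact: hge0.
Qed.

(** * Operator norms and inner products *)

Section operator_norm.
Context (R : realType) (U V : hilbertType R) (f : {linear U -> V}).
Hypothesis f_bounded : bounded_fun_norm f.

Lemma opnorm_ub u : `|u| <= 1 -> `|f u| <= opnorm f.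
Proof.
move=> u1; apply: ub_le_sup; last by exists u.
by have [M hM] := f_bounded 1; exists M => _ [v /= v1 <-]; exact: hM.
Qed.

Lemma opnorm_ge0 : 0 <= opnorm f.
Proof. by apply: le_trans (opnorm_ub (u := 0) _); rewrite ?normr0. Qed.

Lemma le_opnorm u : `|f u| <= opnorm f * `|u|.
Proof.
have [->|u0] := eqVneq u 0; first by rewrite linear0 !normr0 mulr0.
have nu : 0 < `|u| by rewrite normr_gt0.
rewrite -ler_pdivrMr // mulrC -[X in X * _]gtr0_norm ?invr_gt0 //.
rewrite -normrZ -linearZ; apply: opnorm_ub.
by rewrite normrZ normfV normr_id mulVf // gt_eqF.
Qed.

End operator_norm.

Lemma sum_option (V : nmodType) (I : finType) (F : option I -> V) :
  \sum_i F i = F None + \sum_j F (Some j).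
Proof.
rewrite (bigD1 None) //=; congr (_ + _).
rewrite (reindex_omap Some id) /=; last by case.
by apply: eq_bigl => j; rewrite eqxx.
Qed.

Section hdot_theory.
Context (R : realType) (V : hilbertType R).
Implicit Types u v : V.

Lemma hdot_sumr (I : finType) u (F : I -> V) :
  hdot u (\sum_i F i) = \sum_i hdot u (F i).
Proof.
have h := hdot_semi_inner V; apply: (big_morph (hdot u)) => [v w|].
  exact: siDr.
by rewrite -(scale0r u) (siZr h) mul0r.
Qed.

Lemma hdotBl u v (w : V) : hdot (u - v) w = hdot u w - hdot v w.
Proof. by rewrite hdotDl (siNl (hdot_semi_inner V)). Qed.

Lemma hdotBr u v (w : V) : hdot w (u - v) = hdot w u - hdot w v.
Proof. by rewrite ![hdot w _]hdotC hdotBl. Qed.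

Lemma hdot_ge0 u : 0 <= hdot u u.
Proof. exact: si_ge0 (hdot_semi_inner V) u. Qed.

Lemma hdot_sub_le u v : hdot (u - v) (u - v) <= 2 * hdot u u + 2 * hdot v v.
Proof.
have := hdot_ge0 (u + v); rewrite hdotBl !hdotBr !hdotDl.
by rewrite ![hdot _ (u + v)]hdotC !hdotDl (hdotC v u); lra.
Qed.

(** The relative error criterion at one index, with a = G z~ - x and
   b = w~ - y.  Expanding |a + l b|^2 isolates - 2 l (<a, b> + e), which is thus
   at least (1 - s^2) (|a|^2 + |l b|^2); the second bound follows as
   2 l e <= s^2 (|a|^2 + |l b|^2). *)
Lemma error_criterion_gap (l e s : R) (a b : V) :
  0 < l -> s ^+ 2 <= 1 ->
  `|a + l *: b| ^+ 2 + 2 * l * e <= s ^+ 2 * (`|a| ^+ 2 + `|l *: b| ^+ 2) ->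
  (1 - s ^+ 2) / 2 * (l^-1 * hdot a a + l * hdot b b) <= - hdot a b - e /\
  e * (1 - s ^+ 2) <= s ^+ 2 * (- hdot a b - e).
Proof.
move=> l0 s1; rewrite !hdot_norm.
rewrite !(siE (hdot_semi_inner V)) (hdotC b a) => h.
have aa := hdot_ge0 a; have ab := hdot_ge0 (a + l *: b).
rewrite !(siE (hdot_semi_inner V)) (hdotC b a) in ab.
set A := hdot a a in h ab aa *; set C := hdot a b in h ab *.
set D := hdot b b in h ab *.
have li : 0 < l^-1 by rewrite invr_gt0.
have tt : l^-1 * l = 1 by rewrite mulVf // gt_eqF.
have gap : (1 - s ^+ 2) / 2 * (l^-1 * A + l * D) <= - C - e.
  rewrite -(ler_pM2l l0) -(ler_pM2l (ltr0Sn R 1)).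
  have -> : 2 * (l * ((1 - s ^+ 2) / 2 * (l^-1 * A + l * D))) =
    (1 - s ^+ 2) * ((l^-1 * l) * A + l * (l * D)).
    by field; rewrite gt_eqF.
  by rewrite tt; lra.
split => //.
have Q0 : 0 <= A + l * (l * D).
  apply: addr_ge0 => //; apply: mulr_ge0; first exact: ltW.
  by apply: mulr_ge0; [exact: ltW|exact: hdot_ge0].
have e1 : 2 * l * e <= s ^+ 2 * (A + l * (l * D)) by lra.
have e2 : (1 - s ^+ 2) * (A + l * (l * D)) <= 2 * l * (- C - e) by lra.
have l2 : 0 < 2 * l by lra.
rewrite -(ler_pM2l l2) mulrA [leRHS]mulrCA.
apply: le_trans (ler_wpM2l (sqr_ge0 s) e2).
by rewrite [leRHS]mulrCA [leLHS]mulrC; apply: ler_wpM2l; [lra|exact: e1].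
Qed.

End hdot_theory.

(** * The separating affine functions *)

Section algorithm.
Context (R : realType) (n : nat).
Context (H0 : hilbertType R) (H : 'I_n.-1 -> hilbertType R).
Context (T : forall i, hspace H0 H i -> set (hspace H0 H i)).
Context (G : forall i, {linear H0 -> hspace H0 H i}).
Hypothesis G_last : forall z : H0, G None z = z.
Context (Gadj : forall i, hspace H0 H i -> H0).
Hypothesis G_adjoint : forall i, is_adjoint (G i) (@Gadj i).

(** The last component of [wfull] is chosen to make the dual family
   annihilate the range of (G_1, ..., G_n); this is what turns the seemingly
   quadratic phi_k into an affine function. *)
Lemma sum_dot_wfull z (w : forall j, H j) :
  \sum_i hdot (G i z) (wfull Gadj w i) = 0.
Proof.
rewrite sum_option /= G_last (siNr (hdot_semi_inner H0)) hdot_sumr.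
rewrite addrC -sumrB big1 // => j _.
by rewrite (G_adjoint (i := Some j)) subrr.
Qed.

Context (alpha beta : nat -> R) (lambda : nat -> option 'I_n.-1 -> R).
Context (p : nat -> pspace H0 H) (x y : nat -> forall i, hspace H0 H i).
Context (eps : nat -> option 'I_n.-1 -> R).
Context (sigma gamma : R).
Hypothesis gamma_gt0 : 0 < gamma.

Let dual k := dual_residual Gadj y k.
Let primal k := primal_residual G x k.

Lemma sum_dot_dual k z : \sum_i hdot (G i z) (y k i) = hdot z (dual k).
Proof.
rewrite sum_option /= G_last [RHS]hdotC hdotDl hdotC addrC; congr (_ + _).
rewrite hdotC hdot_sumr; apply: eq_bigr => j _.
by rewrite (G_adjoint (i := Some j)).
Qed.

Lemma sum_dot_primal k (w : forall j, H j) :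
  \sum_i hdot (x k i) (wfull Gadj w i) = \sum_j hdot (primal k j) (w j).
Proof.
rewrite sum_option /= (siNr (hdot_semi_inner H0)) hdot_sumr addrC -sumrB.
apply: eq_bigr => j _.
by rewrite [RHS]hdotBl (G_adjoint (i := Some j)).
Qed.

(** The gradient of phi_k for the inner product [gdot gamma]. *)
Definition phi_grad k : pspace H0 H := (gamma^-1 *: dual k, primal k).

Lemma phi_grad_sq k : gdot gamma (phi_grad k) (phi_grad k) =
  gamma^-1 * hdot (dual k) (dual k) + \sum_j hdot (primal k j) (primal k j).
Proof.
rewrite /gdot /= hdotZl hdotC hdotZl; congr (_ + _).
by rewrite mulVKf ?gt_eqF.
Qed.

Lemma phi_affine k q : phi G Gadj x y eps k q =
  gdot gamma (phi_grad k) q - \sum_i (hdot (x k i) (y k i) + eps k i).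
Proof.
rewrite /phi /gdot /= hdotZl mulrA mulfV ?gt_eqF // mul1r hdotC.
rewrite -sum_dot_dual -sum_dot_primal.
rewrite -[LHS]addr0 -[X in _ + X = _](sum_dot_wfull q.1 q.2).
rewrite -!big_split -sumrB /=.
by apply: eq_bigr => i _; rewrite hdotBl !hdotBr; ring.
Qed.

Lemma phi_sub k q r : phi G Gadj x y eps k q - phi G Gadj x y eps k r =
  gdot gamma (phi_grad k) (q - r).
Proof.
have h := @gdot_semi_inner R n H0 H gamma gamma_gt0.
by rewrite !phi_affine (siDr h) (siNr h); ring.
Qed.

Lemma halfH_segment_closed k : segment_closed (halfH G Gadj x y eps k).
Proof.
have h := @gdot_semi_inner R n H0 H gamma gamma_gt0.
move=> q r t /andP[t0 t1]; rewrite /halfH /= => hq hr.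
have := phi_sub k (q + t *: (r - q)) q.
rewrite [q + _]addrC addrK (siZr h) -phi_sub => e.
have := mulr_ge0_le0 (_ : 0 <= 1 - t) hq; have := mulr_ge0_le0 t0 hr.
by move=> ? /(_ ltac:(lra)) ?; lra.
Qed.

Lemma solutions_sub_halfH k :
  (forall i, enlargement (@T i) (eps k i) (x k i) (y k i)) ->
  extended_solutions T G Gadj `<=` halfH G Gadj x y eps k.
Proof.
move=> hen q [q1 q2]; apply: sumr_le0 => i _.
have : T (G i q.1) (wfull Gadj q.2 i).
  by case: i => [j|] /=; [exact: q1|rewrite G_last].
by move=> /hen; rewrite !hdotBl !hdotBr; lra.
Qed.

Lemma Gadj_last (v : H0) : Gadj (i := None) v = v.
Proof.
set d : H0 := Gadj (i := None) v - v; suff : d = 0 by move=> /subr0_eq.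
apply/eqP; rewrite -normr_eq0 -sqrf_eq0 hdot_norm {2}/d hdotBr.
by rewrite -(G_adjoint (i := None)) G_last subrr.
Qed.

Lemma extended_solutions_nonempty : (exists z, is_solution T G Gadj z) ->
  exists q, extended_solutions T G Gadj q.
Proof.
move=> [z [u [uT u0]]]; exists (z, fun j => u (Some j)); split => [j|] /=.
  exact: uT.
have -> : - \sum_j Gadj (u (Some j)) = u None.
  by move: u0; rewrite sum_option Gadj_last addrC => /addr0_eq.
by have := uT None; rewrite G_last.
Qed.

(** * One iteration *)

Hypotheses (sigma_ge0 : 0 <= sigma) (sigma_lt1 : sigma < 1).
Context (lmin lmax : R).
Hypotheses (lmin_gt0 : 0 < lmin).
Hypothesis lambda_bounds : forall k i, lmin <= lambda k i <= lmax.
Let ml := Num.min lmin (1 / lmax).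

(* M stands for the maximum of the squared operator norms; it is at least 1
   because G_n is the identity of a nonzero space. *)
Context (M : R).
Hypotheses (M_ge1 : 1 <= M) (n_gt0 : (0 < n)%N).
Hypothesis G_le : forall i v, hdot (G i v) (G i v) <= M * hdot v v.

Let M_ge0 : 0 <= M := le_trans ler01 M_ge1.

Let pt k : pspace H0 H :=
  (ztilde alpha beta p k, wtilde alpha beta p k).

Let a k i := G i (pt k).1 - x k i.
Let b k i := wfull Gadj (pt k).2 i - y k i.
Let D k := \sum_i (hdot (a k i) (a k i) + hdot (b k i) (b k i)).

Hypothesis err : forall k i,
  error_criterion G Gadj sigma alpha beta lambda p x y eps k i.

Lemma error_gap k i :
  (1 - sigma ^+ 2) / 2 * ((lambda k i)^-1 * hdot (a k i) (a k i)
      + lambda k i * hdot (b k i) (b k i))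
    <= - hdot (a k i) (b k i) - eps k i /\
  eps k i * (1 - sigma ^+ 2) <= sigma ^+ 2 * (- hdot (a k i) (b k i) - eps k i).
Proof.
have /andP[l1 l2] := lambda_bounds k i.
apply: error_criterion_gap.
- exact: lt_le_trans l1.
- by rewrite expr_le1 // ltW.
- have := err k i; rewrite /error_criterion /=.
  congr (_ ^+ 2 + _ <= _); rewrite -[LHS]normrN; congr (`|_|).
  rewrite /a /b scalerBr !opprD !opprK !addrA.
  rewrite -[LHS]addrA -[LHS]addrA [LHS]addrC; congr (_ - _).
  by rewrite addrA [- x k i + _]addrC.
Qed.

Lemma phi_pt k :
  phi G Gadj x y eps k (pt k) = \sum_i (- hdot (a k i) (b k i) - eps k i).
Proof.
apply: eq_bigr => i _; congr (_ - _).
by rewrite -(siNr (hdot_semi_inner _)) opprB.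
Qed.

(** The extrapolated point is separated from [halfH]: both weights 1 / lambda
   and lambda of [error_gap] are at least [ml]. *)
Lemma phi_pt_ge k :
  (1 - sigma ^+ 2) * ml / 2 * D k <= phi G Gadj x y eps k (pt k).
Proof.
rewrite phi_pt mulr_sumr; apply: ler_sum => i _.
have [h _] := error_gap k i; apply: le_trans h.
have /andP[l1 l2] := lambda_bounds k i.
have l0 : 0 < lambda k i := lt_le_trans lmin_gt0 l1.
have ml1 : ml <= lambda k i by rewrite ge_min l1.
have ml2 : ml <= (lambda k i)^-1.
  by rewrite ge_min div1r lef_pV2 ?posrE ?l2 ?orbT // (lt_le_trans l0).
have s1 : 0 <= (1 - sigma ^+ 2) / 2.
  by rewrite divr_ge0 // subr_ge0 expr_le1 // ltW.
rewrite -[_ * ml / 2]mulrA [ml / 2]mulrC mulrA -[leLHS]mulrA.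
apply: ler_wpM2l => //.
by rewrite mulrDr; apply: lerD; apply: ler_wpM2r; rewrite ?hdot_ge0.
Qed.

Lemma sum_eps_le k :
  (\sum_i eps k i) * (1 - sigma ^+ 2) <=
    sigma ^+ 2 * phi G Gadj x y eps k (pt k).
Proof.
rewrite phi_pt mulr_suml mulr_sumr; apply: ler_sum => i _.
by case: (error_gap k i).
Qed.

(** With d the dual residual, |d|^2 is the sum of the <G_i d, y_i - w~_i>.
   Young's inequality with weight n M turns the factors G_i d back into |d|^2,
   which is absorbed on the left. *)
Lemma dual_le k :
  hdot (dual k) (dual k) <= n%:R * M * \sum_i hdot (b k i) (b k i).
Proof.
set d := dual k; set t := n%:R * M.
have t0 : 0 < t by rewrite mulr_gt0 ?ltr0n // (lt_le_trans _ M_ge1).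
have ti : 0 < t^-1 by rewrite invr_gt0.
have dE : hdot d d = \sum_i hdot (G i d) (- b k i).
  rewrite -[LHS](sum_dot_dual k) -[LHS]subr0.
  rewrite -[X in _ - X](sum_dot_wfull d (pt k).2) -sumrB.
  by apply: eq_bigr => i _; rewrite /b opprB hdotBr.
suff : 2 * hdot d d <= hdot d d + t * \sum_i hdot (b k i) (b k i) by lra.
rewrite {1}dE mulr_sumr.
have -> : hdot d d = \sum_(i : option 'I_n.-1) t^-1 * (M * hdot d d).
  rewrite sumr_const card_option card_ord prednK // -mulr_natl.
  by rewrite mulrCA [n%:R * _]mulrA mulKf ?gt_eqF.
rewrite mulr_sumr -big_split /=; apply: ler_sum => i _.
have h := hdot_semi_inner (hspace H0 H i).
apply: le_trans (si_young h _ _ t0) _.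
rewrite (siNl h) (siNr h) opprK; apply: lerD => //.
by apply: ler_wpM2l; [exact: ltW|exact: G_le].
Qed.

(** The j-th primal residual x_j - G_j x_n is G_j (z~ - x_n) - (G_j z~ - x_j),
   a combination of the discrepancies at n and at j. *)
Lemma primal_le k :
  \sum_j hdot (primal k j) (primal k j) <=
    2 * n%:R * M * \sum_i hdot (a k i) (a k i).
Proof.
have aux j : hdot (primal k j) (primal k j) <=
    2 * hdot (a k (Some j)) (a k (Some j)) + 2 * M * hdot (a k None) (a k None).
  pose u : H j := G (Some j) (a k None); pose v : H j := a k (Some j).
  have -> : primal k j = u - v.
    by rewrite /u /v /a G_last linearB opprB [RHS]addrC addrA subrK.
  have hu : hdot u u <= M * hdot (a k None) (a k None) := G_le (Some j) _.
  apply: le_trans (hdot_sub_le u v) _.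
  by rewrite -[hdot (a k (Some j)) _]/(hdot v v); lra.
apply: le_trans (ler_sum _ (fun j _ => aux j)) _.
rewrite big_split /= sumr_const card_ord -mulr_sumr [in leRHS]sum_option.
set S := \sum_j _; set A := hdot _ _.
have S0 : 0 <= S by apply: sumr_ge0 => j _; exact: hdot_ge0.
have A0 : 0 <= A by exact: hdot_ge0.
have nE : n%:R = n.-1%:R + 1 :> R by rewrite natr1 prednK.
have n0 : 0 <= n.-1%:R :> R by [].
have MA : 0 <= M * A by exact: mulr_ge0.
have MS : S <= M * S by rewrite ler_peMl.
have nMS : 0 <= n.-1%:R * (M * S) by apply: mulr_ge0 => //; exact: mulr_ge0.
by rewrite nE; lra.
Qed.

Lemma grad_sq_le k : gdot gamma (phi_grad k) (phi_grad k) <=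
  2 * n%:R * M * Num.max 1 (1 / gamma) * D k.
Proof.
rewrite phi_grad_sq; set mg := Num.max _ _.
have mg1 : 1 <= mg by rewrite le_max lexx.
have mg2 : gamma^-1 <= mg by rewrite -div1r le_max lexx orbT.
rewrite /D big_split /= mulrDr addrC; apply: lerD.
  apply: le_trans (primal_le k) _.
  apply: ler_wpM2r; first by apply: sumr_ge0 => i _; exact: hdot_ge0.
  by rewrite ler_peMr //; apply: mulr_ge0 => //; apply: mulr_ge0.
set Bs := \sum_i _.
have Bs0 : 0 <= Bs by apply: sumr_ge0 => i _; exact: hdot_ge0.
have nM0 : 0 <= n%:R * M by exact: mulr_ge0.
have nB0 := mulr_ge0 nM0 Bs0.
apply: (@le_trans _ _ (mg * (n%:R * M * Bs))).
  apply: ler_pM => //; [by rewrite invr_ge0 ltW|exact: hdot_ge0|exact: dual_le].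
have : 0 <= mg * (n%:R * M * Bs) by apply: mulr_ge0 => //; lra.
lra.
Qed.

Let K := 4 * n%:R * M * Num.max 1 (1 / gamma) / ((1 - sigma ^+ 2) * ml).
Let Es k := gdot gamma (pt k - p k.+1) (pt k - p k.+1).

Lemma one_sub_sigma2_gt0 : 0 < 1 - sigma ^+ 2.
Proof. by rewrite subr_gt0 expr_lt1. Qed.

Lemma ml_gt0 : 0 < ml.
Proof.
have /andP[l1 l2] := lambda_bounds 0 None.
rewrite lt_min lmin_gt0 divr_gt0 //.
by rewrite (lt_le_trans lmin_gt0) // (le_trans l1).
Qed.

Lemma K_gt0 : 0 < K.
Proof.
apply: divr_gt0; last by rewrite mulr_gt0 ?one_sub_sigma2_gt0 ?ml_gt0.
rewrite !mulr_gt0 ?ltr0n //; first exact: lt_le_trans M_ge1.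
by rewrite lt_max ltr01.
Qed.

Lemma grad_sq_le_phi k :
  gdot gamma (phi_grad k) (phi_grad k) <= K * phi G Gadj x y eps k (pt k).
Proof.
apply: le_trans (ler_wpM2l (ltW K_gt0) (phi_pt_ge k)).
apply: le_trans (grad_sq_le k) _; rewrite mulrA; apply: ler_wpM2r.
  by apply: sumr_ge0 => i _; rewrite addr_ge0 ?hdot_ge0.
rewrite /K le_eqVlt; apply/orP; left; apply/eqP.
field; have := ml_gt0; have := one_sub_sigma2_gt0.
by move=> /gt_eqF -> /gt_eqF ->.
Qed.

(** Let g be the gradient and r = p~^k - p^{k+1}.  As phi_k(p^{k+1}) <= 0, one
   has phi_k(p~^k) <= <g, r> <= (|g|^2 / K + K |r|^2) / 2, and |g|^2 / K is at
   most phi_k(p~^k), so it can be absorbed on the left. *)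
Lemma iteration_bounds k : phi G Gadj x y eps k (p k.+1) <= 0 ->
  gdot gamma (phi_grad k) (phi_grad k) <= K ^+ 2 * Es k /\
  phi G Gadj x y eps k (pt k) <= K * Es k.
Proof.
move=> hp; have h := @gdot_semi_inner R n H0 H gamma gamma_gt0.
have g := grad_sq_le_phi k; have K0 := K_gt0.
have yg := si_young h (phi_grad k) (pt k - p k.+1) K0.
rewrite -phi_sub in yg; move: g yg hp; rewrite -/(Es k).
set g := gdot _ _ _; set f := phi _ _ _ _ _ _ _; set f' := phi _ _ _ _ _ _ _.
move=> gf yg f'0.
have gf' : K^-1 * g <= f by rewrite -(ler_pM2l K0) mulrA mulfV ?gt_eqF // mul1r.
have fE : f <= K * Es k by lra.
split => //; apply: le_trans gf _.
by rewrite expr2 -mulrA ler_pM2l.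
Qed.

End algorithm.

(** * Convergence rate *)

Lemma exists_le_mean (R : realType) (E : nat -> R) (S : R) (k : nat) :
  \sum_(0 <= l < k.+1) E l <= S ->
  exists2 l, (l <= k)%N & E l <= S / k.+1%:R.
Proof.
move=> hS; apply: contrapT => hno.
have : \sum_(0 <= l < k.+1) (S / k.+1%:R) < \sum_(0 <= l < k.+1) E l.
  apply: ltr_sum_nat => // l /andP[_ lk]; rewrite ltNge; apply/negP => h.
  by apply: hno; exists l.
by rewrite sumr_const_nat subn0 -[(S / _) *+ _]mulr_natr divfK // ltNge hS.
Qed.

Lemma ler_of_sqr (R : realType) (u v : R) :
  0 <= v -> u ^+ 2 <= v ^+ 2 -> u <= v.
Proof.
move=> v0; have [u0|u0] := leP u 0; first by move=> _; exact: le_trans v0.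
by rewrite ler_pXn2r // nnegrE ltW.
Qed.

Theorem theorem3p14 (R : realType) (n : nat) (n_ge2 : (2 <= n)%N)
    (H0 : hilbertType R) (H : 'I_n.-1 -> hilbertType R)
    (H0_nontrivial : exists z : H0, z != 0)
    (T : forall i, hspace H0 H i -> set (hspace H0 H i))
    (T_maxmon : forall i, maximal_monotone (@T i))
    (G : forall i, {linear H0 -> hspace H0 H i})
    (G_bounded : forall i, bounded_fun_norm (G i))
    (G_last : forall z : H0, G None z = z)
    (Gadj : forall i, hspace H0 H i -> H0)
    (G_adjoint : forall i, is_adjoint (G i) (@Gadj i))
    (solvable : exists z, is_solution T G Gadj z)
    (sigma gamma : R)
    (sigma_ge0 : 0 <= sigma) (sigma_lt1 : sigma < 1) (gamma_gt0 : 0 < gamma)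
    (alpha beta : nat -> R) (lambda : nat -> option 'I_n.-1 -> R)
    (p : nat -> pspace H0 H) (x y : nat -> forall i, hspace H0 H i)
    (eps : nat -> option 'I_n.-1 -> R)
    (run : nonstopping_run T G Gadj sigma gamma alpha beta lambda p x y eps)
    (lmin lmax : R) (lmin_gt0 : 0 < lmin) (lmin_le_lmax : lmin <= lmax)
    (lambda_bounds : forall k i, lmin <= lambda k i <= lmax)
    (alpha_bounded : has_ubound (range alpha))
    (beta_summable : cvgn (series (fun k => beta k ^+ 2))) :
  let abar := sup (range alpha) in
  let bbar := sup (range beta) in
  let sbar := limn (series (fun k => beta k ^+ 2)) in
  let Om := Omega abar bbar sbar in
  let d0 := gdist gamma (p 0%N) (extended_solutions T G Gadj) in
  let nG := n%:R * \big[Num.max/0]_i (opnorm (G i) ^+ 2) in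
  let mg := Num.max 1 (1 / gamma) in
  let ml := Num.min lmin (1 / lmax) in
  forall k : nat, exists l : nat, [/\ (l <= k)%N,
    forall i, enlargement (@T i) (eps l i) (x l i) (y l i),
    `|dual_residual Gadj y l| <=
      nG * d0 / Num.sqrt k.+1%:R *
      ((4 * Num.sqrt gamma * mg * Num.sqrt Om) / ((1 - sigma ^+ 2) * ml)),
    forall j : 'I_n.-1, `|primal_residual G x l j| <=
      nG * d0 / Num.sqrt k.+1%:R *
      ((4 * mg * Num.sqrt Om) / ((1 - sigma ^+ 2) * ml)) &
    \sum_i eps l i <=
      nG * d0 ^+ 2 / k.+1%:R *
      ((4 * sigma ^+ 2 * mg * Om) / ((1 - sigma ^+ 2) ^+ 2 * ml))].
Proof.
move=> abar bbar sbar Om d0 nG mg ml k.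
case: run => run_a run_b _ _ run_enl run_err _ run_step.
have hB := @gdot_semi_inner R n H0 H gamma gamma_gt0.
have n_gt0 : (0 < n)%N := ltnW n_ge2.
set M := \big[Num.max/0]_i (opnorm (G i) ^+ 2) in nG *.
have G_le i v : hdot (G i v) (G i v) <= M * hdot v v.
  rewrite -!hdot_norm.
  apply: (@le_trans _ _ (opnorm (G i) ^+ 2 * `|v| ^+ 2)).
    rewrite -exprMn lerXn2r ?nnegrE ?mulr_ge0 ?opnorm_ge0 //.
    exact: le_opnorm.
  apply: ler_wpM2r; first exact: sqr_ge0.
  exact: (le_bigmax _ (fun i => opnorm (G i) ^+ 2)).
have M_ge1 : 1 <= M.
  have [z z0] := H0_nontrivial; have := G_le None z; rewrite G_last.
  by rewrite ler_pMl // -hdot_norm exprn_gt0 // normr_gt0.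
have [s Ss] := extended_solutions_nonempty G_last G_adjoint solvable.
set S := extended_solutions T G Gadj in d0 Ss *.
have S_sub j : S `<=` halfH G Gadj x y eps j.
  exact: (solutions_sub_halfH G_last (run_enl j)).
have step j : nearest (gdot gamma) (halfH G Gadj x y eps j `&` halfW gamma p j)
    (p 0%N) (p j.+1).
  have [h1 h2] := run_step j; split => // r /h2.
  by rewrite /Defs.gnorm ler_sqrt // (si_ge0 hB).
have conv j : segment_closed (halfH G Gadj x y eps j).
  exact: (@halfH_segment_closed _ _ _ _ _ G_last _ G_adjoint _ _ _ _ gamma_gt0).
have d0_ge0 : 0 <= d0.
  apply: lb_le_inf; first by exists (Defs.gnorm gamma (psub (p 0%N) s)), s.
  by move=> _ [q _ <-]; exact: sqrtr_ge0.
have dist_le j : gdot gamma (p j - p 0%N) (p j - p 0%N) <= d0 ^+ 2.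
  have h0 := si_ge0 hB (p j - p 0%N).
  rewrite -(sqr_sqrtr h0) lerXn2r ?nnegrE ?sqrtr_ge0 //.
  apply: lb_le_inf; first by exists (Defs.gnorm gamma (psub (p 0%N) s)), s.
  move=> _ [q Sq <-]; rewrite /Defs.gnorm ler_sqrt; last exact: si_ge0 hB _.
  exact: (dist_le_solution hB conv S_sub step j Sq).
have alpha_le j : 0 <= alpha j <= abar.
  by rewrite run_a /=; apply: ub_le_sup => //; exists j.
have sum_beta j : \sum_(0 <= l < j) beta l ^+ 2 <= sbar.
  apply: nondecreasing_cvgn_le beta_summable j.
  apply/nondecreasing_seqP => i.
  by rewrite /series /= big_nat_recr //= lerDl sqr_ge0.
have sbar0 : 0 <= sbar by have := sum_beta 0%N; rewrite big_nil.
have beta_le j : 0 <= beta j <= bbar.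
  rewrite run_b /=; apply: ub_le_sup; last by exists j.
  (* From beta_i^2 <= sbar and 2 beta_i <= 1 + beta_i^2. *)
  exists (1 + sbar) => _ [i _ <-].
  have : beta i ^+ 2 <= sbar.
    apply: le_trans (sum_beta i.+1); rewrite big_nat_recr //= lerDr.
    by apply: sumr_ge0 => l _; exact: sqr_ge0.
  by have := sqr_ge0 (beta i - 1); have := run_b i; rewrite expr2; nra.
pose pt j : pspace H0 H := (ztilde alpha beta p j, wtilde alpha beta p j).
have ptE j : pt j = (p j + alpha j *: (p j - p j.-1))
    + beta j *: ((p j + alpha j *: (p j - p j.-1)) - p 0%N) by [].
have := sum_inertial_le hB step ptE alpha_le beta_le (sum_beta k.+1) dist_le.
rewrite -/Om => /exists_le_mean[l lk El].
have abar0 : 0 <= abar by have /andP[h] := alpha_le 0%N; exact: le_trans.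
have bbar0 : 0 <= bbar by have /andP[h] := beta_le 0%N; exact: le_trans.
have Om0 : 0 <= Om.
  by rewrite /Om /Omega; do ?[apply: mulr_ge0|apply: addr_ge0].
have phi_le0 : phi G Gadj x y eps l (p l.+1) <= 0 by have [[]] := step l.
have [grad_le phi_le] := iteration_bounds G_last G_adjoint gamma_gt0 sigma_ge0
  sigma_lt1 lmin_gt0 lambda_bounds M_ge1 n_gt0 G_le run_err phi_le0.
have eps_le := sum_eps_le sigma_ge0 sigma_lt1 lmin_gt0 lambda_bounds run_err l.
have K0 := @K_gt0 R n lambda sigma gamma sigma_ge0 sigma_lt1 lmin lmax lmin_gt0
  lambda_bounds M M_ge1 n_gt0.
have s0 := one_sub_sigma2_gt0 sigma_ge0 sigma_lt1.
have ml0 := ml_gt0 lmin_gt0 lambda_bounds.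
pose K := 4 * n%:R * M * mg / ((1 - sigma ^+ 2) * ml).
rewrite -/mg -/ml -/K in grad_le phi_le K0 ml0.
rewrite -/(pt l) in grad_le phi_le eps_le.
(* W^2 is the bound for the squared length of p~^l - p^{l+1}. *)
set W := d0 * Num.sqrt Om / Num.sqrt k.+1%:R.
have W2 : W ^+ 2 = Om * d0 ^+ 2 / k.+1%:R.
  by rewrite /W !exprMn exprVn !sqr_sqrtr // [Om * _]mulrC.
rewrite -W2 in El.
have W0 : 0 <= W by apply: divr_ge0; [apply: mulr_ge0|]; rewrite ?sqrtr_ge0.
have KW0 : 0 <= K * W by rewrite mulr_ge0 // ltW.
pose g := phi_grad G Gadj x y gamma l.
have grad_le' : gdot gamma g g <= (K * W) ^+ 2.
  apply: le_trans grad_le _; rewrite [leRHS]exprMn.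
  by apply: ler_wpM2l => //; exact: sqr_ge0.
have phi_le' : phi G Gadj x y eps l (pt l) <= K * W ^+ 2.
  by apply: le_trans phi_le _; apply: ler_wpM2l => //; exact: ltW.
have primal_sum_ge0 : 0 <= \sum_j
    hdot (primal_residual G x l j) (primal_residual G x l j).
  by apply: sumr_ge0 => j _; exact: hdot_ge0.
rewrite /g phi_grad_sq // in grad_le'.
exists l; split => //.
- apply: (@le_trans _ _ (Num.sqrt gamma * (K * W))); last first.
    by rewrite le_eqVlt; apply/orP; left; apply/eqP; rewrite /K /W /nG; ring.
  apply: ler_of_sqr; first by rewrite mulr_ge0 ?sqrtr_ge0.
  rewrite exprMn (sqr_sqrtr (ltW gamma_gt0)) -ler_pdivrMl // hdot_norm.
  by apply: le_trans grad_le'; rewrite lerDl.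
- move=> j; apply: (@le_trans _ _ (K * W)); last first.
    by rewrite le_eqVlt; apply/orP; left; apply/eqP; rewrite /K /W /nG; ring.
  apply: ler_of_sqr => //; rewrite hdot_norm; apply: le_trans grad_le'.
  rewrite (bigD1 j) //= addrA [X in _ <= X + _]addrC -addrA lerDl.
  apply: addr_ge0; first by rewrite mulr_ge0 ?hdot_ge0 // invr_ge0 ltW.
  by apply: sumr_ge0 => i _; exact: hdot_ge0.
- apply: (@le_trans _ _ (sigma ^+ 2 * (K * W ^+ 2) / (1 - sigma ^+ 2))).
    rewrite ler_pdivlMr //; apply: le_trans eps_le _.
    by apply: ler_wpM2l => //; exact: sqr_ge0.
  rewrite le_eqVlt; apply/orP; left; apply/eqP; rewrite W2 /K /nG.
  field; apply/and3P; split; first by rewrite gt_eqF.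
    by rewrite gt_eqF.
  by rewrite nat1r gt_eqF.
Qed.
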